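(* Let $L>0$, $r>0$, let $\Pi(z)=\sqrt{z(2-z)}\,e^{-z/2}$ for $z\in[0,2]$, and let $k_I^*=\frac{r}{2L}\Pi(2-\sqrt2)$. Take $k_I\in(0,k_I^* )$ and $\mu\in(0,(2-\sqrt2)/L]$ such that $\frac{r}{2L}\Pi(\mu L)>k_I$. Let $q_1=2k_I$ and $q_2=rk_Ie^{-\mu L/2}$, and define, for $(\phi,\xi)\in Z=L^2(0,L)\times\mathbb R$, $$V(\phi,\xi)=\int_0^L\Big[\phi^2(x)e^{-\mu x}+q_1\xi\phi(x)e^{-\mu x/2}\Big]dx+q_2\xi^2.$$ Then there exist constants $M\ge1$ and $\alpha>0$ such that $$M^{-1}\|(\phi,\xi)\|_Z^2\le V(\phi,\xi)\le M\|(\phi,\xi)\|_Z^2\qquad\forall\,(\phi,\xi)\in Z,$$ and, for every smooth compatible $(\phi_0,\xi_0)\in Z$, the solution of $$\phi_t=-r\phi_x,\quad \dot\xi(t)=\phi(L,t),\quad\phi(0,t)=-k_I\xi(t),\quad\phi(x,0)=\phi_0(x),\quad\xi(0)=\xi_0$$ (on $x\in(0,L)$, $t\ge0$) satisfies, for all $t\geq 0$, $$\frac{d}{dt}V(\phi(\cdot,t),\xi(t))\le-\alpha\,V(\phi(\cdot,t),\xi(t))-\frac{re^{-\mu L}}{2}\,\phi^2(L,t).$$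
   Context: $Z=L^2(0,L)\times\mathbb R$ has the norm $\|(\phi,\xi)\|_Z^2=\int_0^L\phi^2dx+\xi^2$. ''Smooth compatible'' initial data means that $\phi_0$ is smooth enough and satisfies the boundary compatibility conditions to the order needed (namely $\phi_0(0)=-k_I\xi_0$ and $r\phi_0'(0)=k_I\phi_0(L)$) so that the solution $\phi$ is continuously differentiable with respect to $t$ and $x$ on $[0,L]\times[0,\infty)$. *)

(* Defs.v *)
From mathcomp Require Import all_boot all_order all_algebra.
From mathcomp Require Import all_classical all_reals all_analysis.

Set Implicit Arguments.
Unset Strict Implicit.
Unset Printing Implicit Defensive.
Import Order.TTheory GRing.Theory Num.Theory.
Import numFieldNormedType.Exports.

Local Open Scope classical_set_scope.
Local Open Scope ring_scope.

(* Only meaningful for z in [0, 2]: Num.sqrt is 0 on negative numbers. *)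
Definition PiFun {R : realType} (z : R) : R :=
  Num.sqrt (z * (2 - z)) * expR (- z / 2).

Definition kI_star {R : realType} (L r : R) : R :=
  r / (2 * L) * PiFun (2 - Num.sqrt 2).

(* Elements of L^2(0, L) are given by representatives R -> R, of which only
   the values on ]0, L[ matter: the zero extension has to be in L^2(R). *)
Definition inZ {R : realType} (L : R) (z : (R -> R) * R) : Prop :=
  z.1 \_ `]0, L[ \in Lfun (@lebesgue_measure R) 2%:E.

(* The square of the norm of Z. *)
Definition Znorm2 {R : realType} (L : R) (z : (R -> R) * R) : R :=
  (\int[lebesgue_measure]_(x in `]0, L[) (z.1 x ^+ 2)) + z.2 ^+ 2.

Definition V {R : realType} (L r kI mu : R) (z : (R -> R) * R) : R :=
  let q1 := 2 * kI in
  let q2 := r * kI * expR (- (mu * L) / 2) in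
  (\int[lebesgue_measure]_(x in `]0, L[)
     (z.1 x ^+ 2 * expR (- (mu * x)) +
      q1 * z.2 * z.1 x * expR (- (mu * x) / 2)))
  + q2 * z.2 ^+ 2.

(* l is the derivative at x of f restricted to D; it is one-sided when x is an
   endpoint of the interval D, and the usual derivative when x is interior. *)
Definition has_derive_within {R : realType} (D : set R) (f : R -> R)
    (x l : R) : Prop :=
  (f y - f x) / (y - x) @[y --> within D x^'] --> l.

Definition smooth_compatible {R : realType} (L r kI : R)
    (z0 : (R -> R) * R) : Prop :=
  exists dphi0 : R -> R,
    [/\ {in `[0, L], forall x, has_derive_within `[0, L] z0.1 x (dphi0 x)},
        {within `[0, L], continuous dphi0},
        z0.1 0 = - kI * z0.2 &
        r * dphi0 0 = kI * z0.1 L].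

(* phi (x, t), continuously differentiable on [0, L] x [0, oo[, and xi t form
   a classical solution of the closed loop; phix and phit are the partial
   derivatives of phi. *)
Record is_solution {R : realType} (L r kI : R) (z0 : (R -> R) * R)
    (phi : R * R -> R) (xi : R -> R) (phix phit : R * R -> R) : Prop := {
  sol_phix : forall x t : R, 0 <= x <= L -> 0 <= t ->
    has_derive_within `[0, L] (fun y => phi (y, t)) x (phix (x, t));
  sol_phit : forall x t : R, 0 <= x <= L -> 0 <= t ->
    has_derive_within `[0, +oo[ (fun s => phi (x, s)) t (phit (x, t));
  sol_cont : {within `[0, L] `*` `[0, +oo[, continuous phi};
  sol_phix_cont : {within `[0, L] `*` `[0, +oo[, continuous phix};
  sol_phit_cont : {within `[0, L] `*` `[0, +oo[, continuous phit};
  sol_transport : forall x t : R, 0 < x < L -> 0 <= t ->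
    phit (x, t) = - r * phix (x, t);
  sol_xi : forall t : R, 0 <= t ->
    has_derive_within `[0, +oo[ xi t (phi (L, t));
  sol_boundary : forall t : R, 0 <= t -> phi (0, t) = - kI * xi t;
  sol_init_phi : forall x : R, 0 < x < L -> phi (x, 0) = z0.1 x;
  sol_init_xi : xi 0 = z0.2 }.

(* Main.v *)
(** With g(x) = phi(x) e^(-mu x/2), V = int g^2 + 2 kI xi int g + q2 xi^2.
    Differentiating under the integral sign and using g_t = - r g_x - (r mu/2) g,
    integration over ]0, L[ gives V' as a combination of int g^2, int g, xi^2 and
    phi(L)^2, in which the products xi phi(L) cancel thanks to the choice of q1
    and q2. Both claims are then inequalities of the form
      c int_0^L g^2 + d int_0^L g + e L >= 0,
    and follow by integrating the pointwise inequality c y^2 + d y + e >= 0. *)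

Require Import Defs.
From mathcomp Require Import all_boot all_order all_algebra.
From mathcomp Require Import all_classical all_reals all_analysis.
From mathcomp Require Import measurable_realfun ring lra.

Set Implicit Arguments.
Unset Strict Implicit.
Unset Printing Implicit Defensive.
Import Order.TTheory GRing.Theory Num.Theory.
Import numFieldNormedType.Exports.

Local Open Scope classical_set_scope.
Local Open Scope ring_scope.

(** * Quadratic forms in two variables *)

(** The constant is determinant over trace, a lower bound for the smallest eigenvalue of the
    form. *)
Lemma posdef_lower (R : realFieldType) (a b d : R) : 0 < a -> b ^+ 2 < a * d ->
  exists2 c, 0 < c & forall x y,
    c * (x ^+ 2 + y ^+ 2) <= a * x ^+ 2 + 2 * b * x * y + d * y ^+ 2.
Proof.
move=> a0 bad.
have d0 : 0 < d.
  rewrite -(pmulr_rgt0 _ a0); exact: le_lt_trans (sqr_ge0 b) bad.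
have ad0 : 0 < a + d by rewrite addr_gt0.
exists ((a * d - b ^+ 2) / (a + d)).
  by rewrite divr_gt0 ?subr_gt0.
set c := _ / _ => x y.
have cE : c * (a + d) = a * d - b ^+ 2 by rewrite /c mulfVK ?gt_eqF.
have ac : 0 < a - c.
  rewrite -(pmulr_lgt0 _ ad0) mulrBl cE.
  have -> : a * (a + d) - (a * d - b ^+ 2) = a ^+ 2 + b ^+ 2 by ring.
  by rewrite ltr_pwDl ?sqr_ge0 ?exprn_gt0.
rewrite -subr_ge0 -(pmulr_rge0 _ ac).
(* Completing the square in [x] leaves the coefficient [(a - c) * (d - c) - b ^+ 2] on [y ^+ 2].
   This is [c ^+ 2] plus a remainder that vanishes by [cE]. *)
have -> : (a - c) * (a * x ^+ 2 + 2 * b * x * y + d * y ^+ 2 - c * (x ^+ 2 + y ^+ 2))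
  = ((a - c) * x + b * y) ^+ 2 + (c * y) ^+ 2
    + (a * d - b ^+ 2 - c * (a + d)) * y ^+ 2 by ring.
by rewrite cE subrr mul0r addr0 addr_ge0 ?sqr_ge0.
Qed.

Lemma quadratic_upper (R : realFieldType) (a b d : R) :
  exists2 c, 0 < c & forall x y,
    a * x ^+ 2 + 2 * b * x * y + d * y ^+ 2 <= c * (x ^+ 2 + y ^+ 2).
Proof.
exists (1 + `|a| + `|b| + `|d|) => [|x y].
  by rewrite -!addrA ltr_pwDl// !addr_ge0.
have b2 : 2 * b * x * y <= `|b| * (x ^+ 2 + y ^+ 2).
  apply: le_trans (ler_norm _) _; rewrite !normrM normr_nat.
  rewrite -(real_normK (num_real x)) -(real_normK (num_real y)).
  rewrite -subr_ge0 (_ : _ - _ = `|b| * (`|x| - `|y|) ^+ 2); last by ring.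
  by rewrite mulr_ge0 ?sqr_ge0.
have a1 : a * x ^+ 2 <= `|a| * x ^+ 2 by rewrite ler_wpM2r ?sqr_ge0 ?ler_norm.
have d1 : d * y ^+ 2 <= `|d| * y ^+ 2 by rewrite ler_wpM2r ?sqr_ge0 ?ler_norm.
have a2 : 0 <= `|a| * y ^+ 2 by rewrite mulr_ge0 ?sqr_ge0.
have d2 : 0 <= `|d| * x ^+ 2 by rewrite mulr_ge0 ?sqr_ge0.
have x2 := sqr_ge0 x; have y2 := sqr_ge0 y.
nra.
Qed.

(** * Calculus of derivatives relative to a set *)

Section derive_within.
Context {R : realType}.
Implicit Types (D : set R) (f g : R -> R).

Lemma has_derive_within_cvg D f x l : has_derive_within D f x l ->
  f y @[y --> within D x^'] --> f x.
Proof.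
move=> dfx.
(* For [y != x], [f y] is [f x] plus the difference quotient times [y - x], and the last factor
   tends to 0. *)
have -> : f x = f x + l * (x - x) by rewrite subrr mulr0 addr0.
have lim : f x + (f y - f x) / (y - x) * (y - x) @[y --> within D x^'] -->
    f x + l * (x - x).
  apply: cvgD; first exact: cvg_cst.
  apply: cvgM => //; apply: cvgB; last exact: cvg_cst.
  by move=> A /nbhs_dnbhs Ax; exact: cvg_within.
apply: cvg_trans lim; apply: near_eq_cvg.
apply: (@cvg_within _ x^' _ D); near=> y => /=.
rewrite mulfVK; first by rewrite addrC subrK.
rewrite subr_eq0.
by near: y; exact: nbhs_dnbhs_neq.
Unshelve. all: by end_near. Qed.

Lemma has_derive_within_continuous D f f' :
  (forall x, D x -> has_derive_within D f x (f' x)) -> {within D, continuous f}.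
Proof.
move=> df; apply/subspace_continuousP => x /df /has_derive_within_cvg dfx.
apply/cvgrPdist_lt => e e0; move/cvgrPdist_lt : dfx => /(_ e e0).
rewrite !near_withinE => /nbhs_ballP[d d0 dP].
apply/nbhs_ballP; exists d => // y xy Dy.
by have [->|yx] := eqVneq y x; [rewrite subrr normr0|exact: dP].
Qed.

Lemma has_derive_withinD D f g x df dg :
  has_derive_within D f x df -> has_derive_within D g x dg ->
  has_derive_within D (fun y => f y + g y) x (df + dg).
Proof.
move=> hf hg; apply: cvg_trans; last exact: cvgD hf hg.
by apply: near_eq_cvg; near=> y; rewrite /= opprD addrACA mulrDl.
Unshelve. all: by end_near. Qed.

Lemma has_derive_withinM D f g x df dg :
  has_derive_within D f x df -> has_derive_within D g x dg ->
  has_derive_within D (fun y => f y * g y) x (df * g x + f x * dg).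
Proof.
move=> hf hg; have cg := has_derive_within_cvg hg.
have lim : (f y - f x) / (y - x) * g y + f x * ((g y - g x) / (y - x))
    @[y --> within D x^'] --> df * g x + f x * dg.
  by apply: cvgD; apply: cvgM => //; exact: cvg_cst.
apply: cvg_trans lim; apply: near_eq_cvg; near=> y => /=; ring.
Unshelve. all: by end_near. Qed.

Lemma has_derive_within_cst D c x : has_derive_within D (cst c) x 0.
Proof.
rewrite /has_derive_within /cst /=.
under eq_fun do rewrite subrr mul0r.
exact: cvg_cst.
Qed.

Lemma has_derive_within_eq D f g x l : D x -> {in D, f =1 g} ->
  has_derive_within D f x l -> has_derive_within D g x l.
Proof.
move=> Dx fg; apply: cvg_trans; apply: near_eq_cvg.
by rewrite near_withinE; near=> y => Dy; rewrite !fg ?inE.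
Unshelve. all: by end_near. Qed.

Lemma is_derive_within D f (x l : R) : is_derive x 1 f l -> has_derive_within D f x l.
Proof.
move=> [dfx <-]; apply: cvg_within_filter.
move/cvg_ex : dfx => /= [l' hl].
have -> : 'D_1 f x = l' by exact: cvg_lim hl.
apply/cvgrPdist_lt => e e0; move/cvgrPdist_lt : hl => /(_ e e0).
move=> /nbhs_ballP[d /= d0 dP].
apply/nbhs_ballP; exists d => //= y xy yx.
have := dP (y - x); rewrite /= -[_ *: 1]/(_ * 1) mulr1 subrK subr_eq0 mulrC.
by apply => //; rewrite -ball_normE /= sub0r normrN distrC.
Qed.

(** At interior points this gives access to the mean value theorem and the fundamental theorem of
    calculus, which use two-sided derivatives. *)
Lemma has_derive_within_is_derive D f (x l : R) : nbhs x D ->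
  has_derive_within D f x l -> is_derive x 1 f l.
Proof.
move=> xD hl.
suff h : h^-1 *: ((f \o shift x) (h *: 1) - f x) @[h --> 0^'] --> l.
  by split; [apply/cvg_ex; exists l|exact: cvg_lim h].
apply/cvgrPdist_lt => e e0; move/cvgrPdist_lt : hl => /(_ e e0).
rewrite near_withinE => /nbhs_ballP[d /= d0 dP].
have /nbhs_ballP[d' /= d'0 dP'] := xD.
apply/nbhs_ballP; exists (Num.min d d') => /= [|h]; first by rewrite lt_min d0.
rewrite -ball_normE /= sub0r normrN lt_min => /andP[hd hd'] h0.
have := dP (h + x); rewrite -[_ *: 1]/(_ * 1) mulr1 addrK mulrC; apply.
- by rewrite -ball_normE /= opprD addrCA subrr addr0 normrN.
- by rewrite -subr_eq0 addrK.
- by apply: dP'; rewrite -ball_normE /= opprD addrCA subrr addr0 normrN.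
Qed.

End derive_within.

(** * Integrals over bounded open intervals, and differentiation under the integral sign *)

Section interval_integrals.
Context {R : realType}.
Local Notation mu := (@lebesgue_measure R).
Implicit Types (a b : R) (F : R * R -> R).

Lemma within_continuous_slice (A B : set R) F t : B t ->
  {within A `*` B, continuous F} -> {within A, continuous (fun x => F (x, t))}.
Proof.
move=> Bt /subspace_continuousP cF; apply/subspace_continuousP => x Ax.
apply/cvgrPdist_lt => e e0.
move: (cF (x, t) (conj Ax Bt)) => /cvgrPdist_lt /(_ e e0).
rewrite !near_withinE => /nbhs_ballP[d /= d0 dP].
apply/nbhs_ballP; exists d => //= y xy Ay.
by apply: (dP (y, t)) => //; split => //=; exact: ballxx.
Qed.

Lemma within_continuousM (T : topologicalType) (A : set T) (f g : T -> R) :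
  {within A, continuous f} -> {within A, continuous g} ->
  {within A, continuous (fun x => f x * g x)}.
Proof. by move=> cf cg x; apply: cvgM; [exact: cf|exact: cg]. Qed.

Lemma continuous_itv_integrable a b (f : R -> R) :
  {within `[a, b], continuous f} -> mu.-integrable `]a, b[ (EFin \o f).
Proof.
move=> cf.
have := continuous_compact_integrable (@segment_compact _ a b) cf.
apply: integrableS => //; exact: subset_itv_oo_cc.
Qed.

Lemma integrable_oo_cst a b (c : R) : mu.-integrable `]a, b[ (EFin \o cst c).
Proof.
by apply: continuous_itv_integrable; apply: continuous_subspaceT; exact: cst_continuous.
Qed.

Lemma Rintegral_oo_cst a b c : a <= b -> \int[mu]_(x in `]a, b[) c = c * (b - a).
Proof.
move=> ab; transitivity (c * fine (mu `]a, b[)); first exact: Rintegral_cst.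
rewrite lebesgue_measure_itv /= lte_fin.
by case: ltgtP ab => //= -> _; rewrite subrr.
Qed.

Lemma normr_Rintegral_oo_le a b c (f : R -> R) : a <= b ->
  mu.-integrable `]a, b[ (EFin \o f) ->
  (forall x, x \in `]a, b[ -> `|f x| <= c) ->
  `|\int[mu]_(x in `]a, b[) f x| <= c * (b - a).
Proof.
move=> ab fi fc; rewrite -Rintegral_oo_cst//.
apply: le_trans (le_normr_Rintegral _ fi) _ => //.
apply: le_Rintegral => //.
- exact: integrable_norm.
- exact: integrable_oo_cst.
Qed.

(** Inside the interval the relative derivative is the usual one. At the endpoints only the
    continuity of [h] matters, and the one-sided derivatives provide it. *)
Lemma Rintegral_derive_within a b (h h' : R -> R) : a < b ->
  (forall x, x \in `[a, b] -> has_derive_within `[a, b] h x (h' x)) ->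
  {within `[a, b], continuous h'} ->
  \int[mu]_(x in `]a, b[) h' x = h b - h a.
Proof.
move=> ab dh ch'.
have hi := continuous_itv_integrable ch'.
have dh' x : x \in `]a, b[ -> is_derive x (1 : R) h (h' x).
  move=> xab; apply: (@has_derive_within_is_derive _ `[a, b]).
    by near=> y; apply: subset_itv_oo_cc; near: y; exact: near_in_itvoo.
  by apply: dh; exact: subset_itv_oo_cc.
(* Endpoints are negligible, so the integral can be taken over the closed interval. *)
rewrite /Rintegral -(@integral_itv_bndoo _ _ _ _ true false); last first.
  exact: (measurable_int mu).
rewrite (@continuous_FTC2 _ h' h) //.
  have /(continuous_within_itvP _ ab)[_ ha hb] := has_derive_within_continuous dh.
  by split => // x /dh'[].
by move=> x /dh' xd; rewrite derive1E derive_val.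
Unshelve. all: by end_near. Qed.

(** By the mean value theorem each difference quotient is [Ft (x, c)] for some [c] between [s] and
    [t]. Compactness of [[a, b]] makes its distance to [Ft (x, t)] small uniformly in [x], and this
    bound is integrated. *)
Lemma has_derive_within_Rintegral a b F Ft : a < b ->
  (forall x t, x \in `[a, b] -> 0 <= t ->
    has_derive_within `[0, +oo[ (fun s => F (x, s)) t (Ft (x, t))) ->
  {within `[a, b] `*` `[0, +oo[, continuous F} ->
  {within `[a, b] `*` `[0, +oo[, continuous Ft} ->
  forall t, 0 <= t ->
  has_derive_within `[0, +oo[ (fun s => \int[mu]_(x in `]a, b[) F (x, s)) t
    (\int[mu]_(x in `]a, b[) Ft (x, t)).
Proof.
move=> ab dF cF cFt t t0.
have t0y (s : R) : 0 <= s -> [set` `[0, +oo[] s by rewrite /= in_itv /= andbT.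
have Fi s : 0 <= s -> mu.-integrable `]a, b[ (EFin \o fun x => F (x, s)).
  by move=> /t0y s0; apply: continuous_itv_integrable; exact: within_continuous_slice cF.
have Fti : mu.-integrable `]a, b[ (EFin \o fun x => Ft (x, t)).
  by apply: continuous_itv_integrable; exact: (within_continuous_slice (t0y _ t0)) cFt.
apply/cvgrPdist_le => e e0.
have ba0 : 0 < b - a by rewrite subr_gt0.
have [d /= d0 dP] : exists2 d : R, 0 < d & forall s, `|t - s| < d -> 0 <= s ->
    forall x, x \in `[a, b] -> `|Ft (x, t) - Ft (x, s)| <= e / (b - a).
  have e2 : 0 < e / (b - a) / 2 by rewrite !divr_gt0.
  (* Tube argument: near each [x], both [Ft (y, s)] and [Ft (y, t)] are within half the tolerance of
     [Ft (x, t)]. Compactness then selects one neighbourhood of [t] for all [x]. *)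
  have : \forall s \near within `[0, +oo[ (nbhs t), `[a, b] `<=`
      [set x | `[a, b]%classic x -> `|Ft (x, t) - Ft (x, s)| <= e / (b - a)].
    apply: (compact_near_coveringP _).1; first exact: segment_compact.
    move=> x xab.
    move/subspace_continuousP : cFt => /(_ (x, t) (conj xab (t0y _ t0))).
    move=> /cvgrPdist_lt /(_ _ e2).
    rewrite near_withinE => /nbhs_ballP[d /= d0 dP].
    exists (ball x d, [set s | ball t d s /\ 0 <= s]) => /=.
      split; first exact: nbhsx_ballx.
      apply/nbhs_ballP; exists d => //= s ts; rewrite in_itv/= andbT.
      by [].
    move=> [y s] /= [xy [ts s0]] yab.
    have h1 := dP (y, s) (conj xy ts) (conj yab (t0y _ s0)).
    have h2 := dP (y, t) (conj xy (ballxx _ d0)) (conj yab (t0y _ t0)).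
    rewrite (splitr (e / (b - a))).
    apply: le_trans (ler_distD (Ft (x, t)) _ _) _.
    by rewrite lerD ?ltW// distrC.
  rewrite near_withinE => /nbhs_ballP[d /= d0 dP].
  exists d => // s ts s0 x xab; apply: (dP s) => //.
  exact: t0y.
rewrite near_withinE; apply/nbhs_ballP; exists d => //= s ts st.
rewrite in_itv /= andbT => s0.
have cB : {within `[a, b], continuous (fun x => F (x, s) - F (x, t))}.
  by move=> x; apply: cvgB; apply: within_continuous_slice cF _ => //; exact: t0y.
have cQ : {within `[a, b], continuous (fun x => (F (x, s) - F (x, t)) / (s - t))}.
  by apply: within_continuousM => // x; exact: cvg_cst.
rewrite -RintegralB//; [|exact: Fi..].
rewrite -RintegralZr//; last exact: continuous_itv_integrable.
rewrite -RintegralB//; last exact: continuous_itv_integrable.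
rewrite (_ : e = e / (b - a) * (b - a)); last by rewrite divfK ?gt_eqF.
apply: normr_Rintegral_oo_le => //.
- exact: ltW.
- apply: continuous_itv_integrable => x; apply: cvgB; last exact: cQ.
  by apply: within_continuous_slice cFt _; exact: t0y.
move=> x xab.
have xabc : x \in `[a, b] by exact: subset_itv_oo_cc.
(* Every point of []u, v[] is positive, hence interior to the time half-line, so differentiability
   in the usual sense holds there even when [u] is 0. *)
have mvt (u v : R) : 0 <= u -> u < v ->
    exists2 c, c \in `]u, v[ & F (x, v) - F (x, u) = Ft (x, c) * (v - u).
  move=> u0 uv; apply: (@MVT _ (fun s => F (x, s)) (fun s => Ft (x, s)) _ _ uv) => [y|].
    rewrite in_itv/= => /andP[uy _]; have y0 := le_lt_trans u0 uy.
    apply: (@has_derive_within_is_derive _ `[0, +oo[); last exact: dF xabc (ltW y0).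
    by near=> z; apply: t0y; near: z; exact: lt_le_nbhsr.
  have : {within `[0, +oo[, continuous (fun s => F (x, s))}.
    apply: (@has_derive_within_continuous _ _ _ (fun s => Ft (x, s))) => z.
    by rewrite /= in_itv/= andbT; exact: dF.
  apply: continuous_subspaceW => z /=.
  by rewrite !in_itv/= andbT => /andP[/(le_trans u0)].
have [c [tc c0 ->]] : exists c, [/\ `|t - c| < d, 0 <= c &
    (F (x, s) - F (x, t)) / (s - t) = Ft (x, c)].
  case: (ltgtP t s) st => // [lts|lst] _.
    have [c ctx FE] := mvt _ _ t0 lts; move: ctx; rewrite in_itv/= => /andP[tc cs].
    exists c; split.
    + by apply: le_lt_trans ts; rewrite ler0_norm ?ler0_norm; lra.
    + exact: le_trans (ltW tc).
    + by rewrite FE mulfK// subr_eq0 gt_eqF.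
  have [c ctx FE] := mvt _ _ s0 lst; move: ctx; rewrite in_itv/= => /andP[sc ct].
  exists c; split.
  + by apply: le_lt_trans ts; rewrite ger0_norm ?ger0_norm; lra.
  + exact: le_trans (ltW sc).
  + by rewrite -opprB FE -[s - t]opprB invrN mulrNN mulfK// subr_eq0 gt_eqF.
exact: dP.
Unshelve. all: by end_near. Qed.

End interval_integrals.

(** * The gain condition, the weighted state and the functional [V] *)

Section lyapunov.
Context {R : realType}.
Local Notation leb := (@lebesgue_measure R).

(** The first bound follows from [s <= 1] and will make [V] positive definite. The second is the
    square of the hypothesis and will make the dissipation positive definite. *)
Lemma gain_bounds (L r kI mu : R) : 0 < L -> 0 < r -> 0 < kI ->
  kI < r / (2 * L) * PiFun (mu * L) ->
  let E := expR (- (mu * L) / 2) in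
  kI * L < r * E /\ 2 * kI ^+ 2 * L < r ^+ 2 * E ^+ 2 * mu * (1 - mu * L / 2).
Proof.
move=> L0 r0 k0; rewrite /PiFun /=.
set z := mu * L; set s := Num.sqrt _; set E := expR _ => hk.
have E0 : 0 < E by exact: expR_gt0.
have hk' : 2 * L * kI < r * s * E.
  have -> : r * s * E = 2 * L * (r / (2 * L) * (s * E)) by field; rewrite gt_eqF.
  by rewrite ltr_pM2l// mulr_gt0.
(* Positivity of [kI] excludes the default value 0 of the square root, so that [s ^+ 2] really is
   [z * (2 - z)]. *)
have s0 : 0 < s.
  have : 0 < r * s * E by apply: lt_trans hk'; rewrite !mulr_gt0.
  by rewrite pmulr_lgt0// pmulr_rgt0.
have s2 : s ^+ 2 = z * (2 - z) by rewrite sqr_sqrtr// ltW// -sqrtr_gt0.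
have s1 : s <= 1.
  rewrite -(@ler_pXn2r _ 2) ?nnegrE ?ler01 ?(ltW s0)// expr1n s2 -subr_ge0.
  by rewrite (_ : _ - _ = (1 - z) ^+ 2) ?sqr_ge0//; ring.
split.
  have rE0 : 0 < r * E by rewrite mulr_gt0.
  have : r * s * E <= r * E by rewrite mulrAC ler_piMr// ltW.
  have := mulr_gt0 L0 k0.
  nra.
have : (2 * L * kI) ^+ 2 < (r * s * E) ^+ 2.
  by rewrite ltr_pXn2r// nnegrE ?ltW// !mulr_gt0.
rewrite !exprMn s2 -(ltr_pM2l (_ : 0 < 2 * L)) ?mulr_gt0// => h.
rewrite -(ltr_pM2l (_ : 0 < 4 * L ^+ 2)) ?mulr_gt0 ?exprn_gt0//.
by move: h; rewrite /z; lra.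
Qed.

(** The scalars [xi] and [phi (L, t)] do not depend on [x] and will enter through [d] and [e].
    Integrating pointwise thus takes the place of a Cauchy-Schwarz estimate between the two
    integrals. *)
Lemma Rintegral_quadratic_ge0 (a b c d e : R) (g : R -> R) : a <= b ->
  leb.-integrable `]a, b[ (EFin \o g) ->
  leb.-integrable `]a, b[ (EFin \o (fun x => g x ^+ 2)) ->
  (forall y, 0 <= c * y ^+ 2 + d * y + e) ->
  0 <= c * (\int[leb]_(x in `]a, b[) (g x ^+ 2)) + d * (\int[leb]_(x in `]a, b[) g x)
       + e * (b - a).
Proof.
move=> ab gi g2i H.
have cgi : leb.-integrable `]a, b[ (EFin \o (fun x => c * g x ^+ 2)).
  exact: (integrableZl _ c g2i).
have dgi : leb.-integrable `]a, b[ (EFin \o (fun x => d * g x)).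
  exact: (integrableZl _ d gi).
rewrite -Rintegral_oo_cst// -RintegralZl// -RintegralZl// -RintegralD// -RintegralD//.
- by apply: Rintegral_ge0 => x _; exact: H.
- exact: (integrableD _ cgi dgi).
- exact: integrable_oo_cst.
Qed.

Section weighted.
Variables (L mu : R).
Hypothesis mu0 : 0 < mu.
Implicit Type phi : R -> R.

(** In this variable the integrand of [V] is a quadratic polynomial whose coefficients do not depend
    on [x]. *)
Definition weighted (phi : R -> R) (x : R) : R := phi x * expR (- (mu * x) / 2).

Lemma weighted_sqr phi x : weighted phi x ^+ 2 = phi x ^+ 2 * expR (- (mu * x)).
Proof. by rewrite /weighted exprMn [X in _ * X]expr2 -expRD -splitr. Qed.

Lemma V_weighted (r kI : R) phi xi :
  leb.-integrable `]0, L[ (EFin \o weighted phi) ->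
  leb.-integrable `]0, L[ (EFin \o (fun x => weighted phi x ^+ 2)) ->
  V L r kI mu (phi, xi) = \int[leb]_(x in `]0, L[) (weighted phi x ^+ 2) +
    2 * kI * xi * (\int[leb]_(x in `]0, L[) weighted phi x) +
    r * kI * expR (- (mu * L) / 2) * xi ^+ 2.
Proof.
move=> gi g2i; rewrite /V /=; congr (_ + _).
rewrite -RintegralZl// -RintegralD//; last exact: (integrableZl _ (2 * kI * xi) gi).
by apply: eq_Rintegral => x _; rewrite weighted_sqr /weighted !mulrA.
Qed.

Lemma continuous_weight : continuous (fun x : R => expR (- (mu * x) / 2)).
Proof.
move=> x; apply: continuous_comp; last exact: continuous_expR.
by apply: cvgM; [apply: cvgN; apply: cvgM; [exact: cvg_cst|exact: cvg_id]|exact: cvg_cst].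
Qed.

Lemma inZ_integrable phi xi : inZ L (phi, xi) ->
  [/\ leb.-integrable `]0, L[ (EFin \o (fun x => phi x ^+ 2)),
      leb.-integrable `]0, L[ (EFin \o weighted phi) &
      leb.-integrable `]0, L[ (EFin \o (fun x => weighted phi x ^+ 2))].
Proof.
rewrite /inZ /= => phiZ.
have mphi : measurable_fun `]0, L[ phi.
  apply: (measurable_restrictT _ _).2 => //.
  have := sub_Lfun_mfun phiZ.
  by rewrite inE.
have phi2 : leb.-integrable `]0, L[ (EFin \o (fun x => phi x ^+ 2)).
  apply: (integrable_mkcond _ _).2 => //.
  have := Lfun2_integrable_sqr phiZ; congr (_.-integrable _ _).
  apply/funext => x; rewrite /= !patchE; case: ifP => // _.
  by rewrite expr0n.
have mw : measurable_fun `]0, L[ (weighted phi).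
  apply: measurable_funM => //; apply: measurable_funTS.
  by apply: continuous_measurable_fun; exact: continuous_weight.
have w1 x : [set` `]0, L[] x -> 0 <= expR (- (mu * x) / 2) <= 1.
  rewrite /= in_itv/= expR_ge0 => /andP[x0 _].
  by rewrite -expR0 ler_expR mulNr oppr_le0 divr_ge0// mulr_ge0// ltW.
split => //.
(* Square integrability gives integrability on a bounded interval, because the absolute value of
   [phi x] is at most [1 + phi x ^+ 2]. *)
- have i1 : leb.-integrable `]0, L[ (EFin \o (fun x => 1 + phi x ^+ 2)).
    exact: (integrableD _ (integrable_oo_cst 0 L 1) phi2).
  apply: (le_integrable _ _ _ i1) => //.
  + exact/measurable_EFinP.
  + move=> x /w1 /andP[h0 h1]; rewrite /= lee_fin /weighted normrM.
    rewrite [in leRHS]ger0_norm ?addr_ge0 ?sqr_ge0// (ger0_norm h0).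
    apply: le_trans (ler_piMr (normr_ge0 _) h1) _.
    rewrite -(real_normK (num_real (phi x))); have := sqr_ge0 (`|phi x| - 1); nra.
- apply: (le_integrable _ _ _ phi2) => //.
  + by apply/measurable_EFinP; exact: measurable_funX.
  + move=> x /w1 /andP[h0 h1]; rewrite /= lee_fin /weighted exprMn normrM ler_piMr//.
    by rewrite ger0_norm ?exprn_ge0// exprn_ile1.
Qed.

(** On []0, L[] the squared weight lies between [expR (- (mu * L))] and 1. *)
Lemma Rintegral_weighted_sqr_bounds phi xi : inZ L (phi, xi) ->
  expR (- (mu * L)) * (\int[leb]_(x in `]0, L[) (phi x ^+ 2)) <=
    \int[leb]_(x in `]0, L[) (weighted phi x ^+ 2) <=
  \int[leb]_(x in `]0, L[) (phi x ^+ 2).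
Proof.
move=> /inZ_integrable[phi2 _ g2].
rewrite -RintegralZl//; apply/andP; split; apply: le_Rintegral => //.
- exact: (integrableZl _ (expR (- (mu * L))) phi2).
- move=> x; rewrite /= in_itv/= => /andP[_ xL].
  by rewrite weighted_sqr mulrC ler_wpM2l ?sqr_ge0// ler_expR lerN2 ler_pM2l// ltW.
- move=> x; rewrite /= in_itv/= => /andP[x0 _].
  by rewrite weighted_sqr ler_piMr ?sqr_ge0// -expR0 ler_expR oppr_le0 mulr_ge0// ltW.
Qed.

End weighted.
End lyapunov.

(** * The derivative of [V] along a solution *)

Section solution.
Context {R : realType} (L r kI mu : R) (z0 : (R -> R) * R).
Variables (phi : R * R -> R) (xi : R -> R) (phix phit : R * R -> R).
Hypotheses (L0 : 0 < L) (sol : is_solution L r kI z0 phi xi phix phit).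
Local Notation leb := (@lebesgue_measure R).

Let w (x : R) := expR (- (mu * x) / 2).
Let G (p : R * R) := phi p * w p.1.
Let Gt (p : R * R) := phit p * w p.1.
Let Gx (p : R * R) := phix p * w p.1 + phi p * (- mu / 2 * w p.1).
Let A t := \int[leb]_(x in `]0, L[) (G (x, t) ^+ 2).
Let B t := \int[leb]_(x in `]0, L[) G (x, t).

Let cw : {within `[0, L] `*` `[0, +oo[, continuous (fun p : R * R => w p.1)}.
Proof.
apply: continuous_subspaceT => p.
by apply: (@continuous_comp _ _ _ fst w); [exact: cvg_fst|exact: continuous_weight].
Qed.

Let cG : {within `[0, L] `*` `[0, +oo[, continuous G}.
Proof. exact: within_continuousM (sol_cont sol) cw. Qed.

Let cGt : {within `[0, L] `*` `[0, +oo[, continuous Gt}.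
Proof. exact: within_continuousM (sol_phit_cont sol) cw. Qed.

Let cGx : {within `[0, L] `*` `[0, +oo[, continuous Gx}.
Proof.
move=> p; apply: cvgD; first exact: within_continuousM (sol_phix_cont sol) cw p.
apply: (within_continuousM (sol_cont sol)) p.
by apply: within_continuousM cw => p; exact: cvg_cst.
Qed.

Let dGt (x t : R) : x \in `[0, L] -> 0 <= t ->
  has_derive_within `[0, +oo[ (fun s => G (x, s)) t (Gt (x, t)).
Proof.
rewrite in_itv /= => xL t0.
(* The added zero is the product-rule term of the weight, which is constant in time. *)
rewrite /Gt -[phit _ * _]addr0 -[X in _ + X](mulr0 (phi (x, t))).
apply: has_derive_withinM; first exact: (sol_phit sol).
exact: (has_derive_within_cst _ (w x)).
Qed.

Let dGx (x t : R) : x \in `[0, L] -> 0 <= t ->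
  has_derive_within `[0, L] (fun y => G (y, t)) x (Gx (x, t)).
Proof.
rewrite in_itv /= => xL t0; apply: has_derive_withinM; first exact: (sol_phix sol).
apply: is_derive_within.
have -> : w = expR \o ((- mu / 2) \*: id).
  by apply/funext => y; rewrite /w /= -[_ *: _]/(_ * _); congr expR; ring.
by apply: is_derive_eq; rewrite mulr1 -[_%:A]/(_ * 1) mulr1 mulrC.
Qed.

Let t0y (t : R) : 0 <= t -> [set` `[0, +oo[] t.
Proof. by rewrite /= in_itv /= andbT. Qed.

(** The transport equation is imposed only for interior [x], which suffices under integrals over
    []0, L[]. *)
Let GtE (x t : R) : 0 <= t -> x \in `]0, L[%classic ->
  Gt (x, t) = - r * Gx (x, t) - r * mu / 2 * G (x, t).
Proof.
move=> t0; rewrite inE /= in_itv/= => x0L.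
by rewrite /Gt /Gx /G /= (sol_transport sol)//; ring.
Qed.

Let slice_integrable (F : R * R -> R) (t : R) : 0 <= t ->
  {within `[0, L] `*` `[0, +oo[, continuous F} ->
  leb.-integrable `]0, L[ (EFin \o (fun x => F (x, t))).
Proof.
by move=> /t0y t0 cF; apply: continuous_itv_integrable; exact: within_continuous_slice cF.
Qed.

Let dB (t : R) : 0 <= t -> has_derive_within `[0, +oo[ B t
  (- r * (G (L, t) - G (0, t)) - r * mu / 2 * B t).
Proof.
move=> t0; have := has_derive_within_Rintegral L0 dGt cG cGt t0.
congr has_derive_within.
rewrite (@eq_Rintegral _ _ _ leb _
  (fun x => - r * Gx (x, t) - r * mu / 2 * G (x, t))); last first.
  by move=> x; exact: GtE.
have Gi := slice_integrable t0 cG; have Gxi := slice_integrable t0 cGx.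
rewrite RintegralB//; [|exact: (integrableZl _ (- r) Gxi)
                       |exact: (integrableZl _ (r * mu / 2) Gi)].
rewrite RintegralZl// RintegralZl//; congr (_ * _ - _).
apply: (@Rintegral_derive_within _ 0 L (fun x => G (x, t))) => //.
  by move=> x xL; exact: dGx.
exact: (within_continuous_slice (t0y t0)) cGx.
Qed.

(** Since [G ^+ 2] is transported with damping rate [r * mu], its [x]-derivative integrates to
    boundary values, and the damping leaves the decay term in [A t]. *)
Let dA (t : R) : 0 <= t -> has_derive_within `[0, +oo[ A t
  (- r * (G (L, t) ^+ 2 - G (0, t) ^+ 2) - r * mu * A t).
Proof.
move=> t0; have cG2 : {within `[0, L] `*` `[0, +oo[, continuous (fun p => G p ^+ 2)}.
  exact: within_continuousM cG cG.
have cGGx : {within `[0, L] `*` `[0, +oo[, continuous (fun p => Gx p * G p + G p * Gx p)}.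
  by move=> p; apply: cvgD; apply: within_continuousM.
have := @has_derive_within_Rintegral _ 0 L (fun p => G p ^+ 2)
  (fun p => Gt p * G p + G p * Gt p) L0 _ cG2 _ t t0.
have -> : \int[leb]_(x in `]0, L[) (Gt (x, t) * G (x, t) + G (x, t) * Gt (x, t))
    = - r * (G (L, t) ^+ 2 - G (0, t) ^+ 2) - r * mu * A t.
  rewrite (@eq_Rintegral _ _ _ leb _
    (fun x => - r * (Gx (x, t) * G (x, t) + G (x, t) * Gx (x, t))
              - r * mu * G (x, t) ^+ 2)); last first.
    by move=> x xL; rewrite GtE//; field.
  have G2i := slice_integrable t0 cG2; have GGxi := slice_integrable t0 cGGx.
  rewrite RintegralB//; [|exact: (integrableZl _ (- r) GGxi)
                         |exact: (integrableZl _ (r * mu) G2i)].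
  rewrite RintegralZl// RintegralZl//; congr (_ * _ - _).
  apply: (@Rintegral_derive_within _ 0 L (fun x => G (x, t) ^+ 2)) => //.
    by move=> x xL; apply: has_derive_withinM; exact: dGx.
  exact: (within_continuous_slice (t0y t0)) cGGx.
apply.
  by move=> x s xL s0; apply: has_derive_withinM; exact: dGt.
by move=> p; apply: cvgD; apply: within_continuousM.
Qed.

Lemma solution_integrable t : 0 <= t ->
  leb.-integrable `]0, L[ (EFin \o weighted mu (fun x => phi (x, t))) /\
  leb.-integrable `]0, L[
    (EFin \o (fun x => weighted mu (fun x => phi (x, t)) x ^+ 2)).
Proof.
move=> t0; split; first exact: slice_integrable t0 cG.
exact: (@slice_integrable (fun p => G p ^+ 2) _ t0 (within_continuousM cG cG)).
Qed.

(** By the boundary condition at 0, [A] contributes [r * kI ^+ 2 * xi t ^+ 2] and the cross term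
    contributes minus twice that amount. The net effect is damping of [xi]. *)
Lemma V_derive_within t : 0 <= t ->
  has_derive_within `[0, +oo[ (fun s => V L r kI mu (fun x => phi (x, s), xi s)) t
    (- r * expR (- (mu * L) / 2) ^+ 2 * phi (L, t) ^+ 2
     + 2 * kI * phi (L, t) * (\int[leb]_(x in `]0, L[) weighted mu (fun x => phi (x, t)) x)
     - r * kI ^+ 2 * xi t ^+ 2
     - r * mu * (\int[leb]_(x in `]0, L[) (weighted mu (fun x => phi (x, t)) x ^+ 2))
     - r * kI * mu * xi t * (\int[leb]_(x in `]0, L[) weighted mu (fun x => phi (x, t)) x)).
Proof.
move=> t0; set E := expR _.
have dxi := sol_xi sol t0.
apply: (@has_derive_within_eq _ _
  (fun s => A s + 2 * kI * (xi s * B s) + r * kI * E * (xi s * xi s))).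
- by rewrite /= in_itv/= andbT.
- move=> s; rewrite inE /= in_itv/= andbT => s0.
  have [gis g2is] := solution_integrable s0.
  by rewrite V_weighted//; rewrite /A /B /E /G /weighted; ring.
rewrite -/(B t) -/(A t).
have G0 : G (0, t) = - kI * xi t.
  by rewrite /G /w /= (sol_boundary sol)// mulr0 oppr0 mul0r expR0 mulr1.
have := has_derive_withinD (has_derive_withinD (dA t0)
  (has_derive_withinM (has_derive_within_cst _ (2 * kI) t)
    (has_derive_withinM dxi (dB t0))))
  (has_derive_withinM (has_derive_within_cst _ (r * kI * E) t)
    (has_derive_withinM dxi dxi)).
congr has_derive_within.
by rewrite G0 /G /w /= -/E; field.
Qed.

End solution.

(** * Choice of the constants, norm equivalence and decay *)

Theorem lemma1 (R : realType) (L r kI mu : R)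
    (L_gt0 : 0 < L) (r_gt0 : 0 < r)
    (kI_gt0 : 0 < kI) (kI_lt : kI < kI_star L r)
    (mu_gt0 : 0 < mu) (mu_le : mu <= (2 - Num.sqrt 2) / L)
    (hmu : kI < r / (2 * L) * PiFun (mu * L)) :
  exists M alpha : R,
    [/\ 1 <= M, 0 < alpha,
        forall (phi : R -> R) (xi : R), inZ L (phi, xi) ->
          M^-1 * Znorm2 L (phi, xi) <= V L r kI mu (phi, xi)
            <= M * Znorm2 L (phi, xi)
      & forall (phi0 : R -> R) (xi0 : R),
          inZ L (phi0, xi0) -> smooth_compatible L r kI (phi0, xi0) ->
          forall (phi : R * R -> R) (xi : R -> R) (phix phit : R * R -> R),
            is_solution L r kI (phi0, xi0) phi xi phix phit ->
            forall t : R, 0 <= t ->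
              exists dV : R,
                has_derive_within `[0, +oo[
                  (fun s => V L r kI mu (fun x => phi (x, s), xi s)) t dV /\
                dV <= - alpha * V L r kI mu (fun x => phi (x, t), xi t)
                      - r * expR (- (mu * L)) / 2 * phi (L, t) ^+ 2].
Proof.
set E := expR (- (mu * L) / 2).
have [hk1 hk2] : kI * L < r * E /\ _ := gain_bounds L_gt0 r_gt0 kI_gt0 hmu.
rewrite -/E in hk2.
have E_gt0 : 0 < E by exact: expR_gt0.
have E2 : expR (- (mu * L)) = E ^+ 2 by rewrite expr2 -expRD -splitr.
have rE_gt0 : 0 < r * E ^+ 2 by rewrite mulr_gt0 ?exprn_gt0.
(* Spreading [q2 * xi ^+ 2] evenly over the interval gives the density [d * xi ^+ 2]. The
   discriminant condition [hd] is then the first gain bound times [kI]. *)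
pose d := r * kI * E / L.
have hd : kI ^+ 2 < 1 * d.
  by rewrite mul1r /d ltr_pdivlMr//; move: hk1; rewrite -(ltr_pM2l kI_gt0); lra.
have [c c_gt0 Vlow] := posdef_lower ltr01 hd.
have [C C_gt0 Vup] := quadratic_upper 1 kI d.
(* [X] is what completing the square in [phi (L, t)] costs. *)
pose X := 2 * kI ^+ 2 * L / (r * E ^+ 2).
have hX : X < r * mu * (1 - mu * L / 2).
  by rewrite /X ltr_pdivrMr//; lra.
have hXa : 0 < r * mu - X.
  by have := mulr_gt0 (mulr_gt0 r_gt0 mu_gt0) (mulr_gt0 mu_gt0 L_gt0); lra.
(* Discriminant condition for the dissipation density. By [hX], [r * mu - X] exceeds
   [r * mu * (mu * L / 2)], twice what is required. *)
have hXb : (r * kI * mu / 2) ^+ 2 < (r * mu - X) * (r * kI ^+ 2 / L).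
  rewrite mulrA ltr_pdivlMr//.
  have -> : (r * kI * mu / 2) ^+ 2 * L = r * mu * (mu * L / 4) * (r * kI ^+ 2) by field.
  rewrite ltr_pM2r ?mulr_gt0 ?exprn_gt0//.
  by have := mulr_gt0 (mulr_gt0 r_gt0 mu_gt0) (mulr_gt0 mu_gt0 L_gt0); lra.
have [c2 c2_gt0 dVlow] := posdef_lower hXa hXb.
(* Each summand serves one estimate: [1 <= M], the two lower bounds [M1] and [M2], and the two upper
   bounds [M3] and [M4]. *)
pose M := 1 + (c * E ^+ 2)^-1 + (c * L)^-1 + C + C * L.
have cE_gt0 : 0 < c * E ^+ 2 by rewrite mulr_gt0 ?exprn_gt0.
have cL_gt0 : 0 < c * L by rewrite mulr_gt0.
have CL_gt0 : 0 < C * L by rewrite mulr_gt0.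
have cEV_gt0 : 0 < (c * E ^+ 2)^-1 by rewrite invr_gt0.
have cLV_gt0 : 0 < (c * L)^-1 by rewrite invr_gt0.
(* The rate compares densities: the dissipation is at least [c2], and the integrand of [V] at most
   [C], times the same sum of squares. *)
exists M, (c2 / C); split.
- by rewrite /M; lra.
- exact: divr_gt0.
- move=> phi xi phiZ.
  have [_ gi g2i] := inZ_integrable mu_gt0 phiZ.
  have := Rintegral_weighted_sqr_bounds mu_gt0 phiZ.
  rewrite E2 V_weighted// /Znorm2 /= -/E.
  set A := \int[_]_(x in _) (weighted _ _ _ ^+ 2).
  set B := \int[_]_(x in _) weighted _ _ _.
  set N := \int[_]_(x in _) _ => /andP[NA AN].
  have N0 : 0 <= N by apply: Rintegral_ge0 => x _; exact: sqr_ge0.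
  have qE : r * kI * E * xi ^+ 2 = d * xi ^+ 2 * L by rewrite /d; field; rewrite gt_eqF.
  have lowB : 0 <= (1 - c) * A + 2 * kI * xi * B + (d - c) * xi ^+ 2 * (L - 0).
    apply: Rintegral_quadratic_ge0 => //; first exact: ltW.
    by move=> y; have := Vlow y xi; lra.
  have upB : 0 <= (C - 1) * A + (- (2 * kI * xi)) * B + (C - d) * xi ^+ 2 * (L - 0).
    apply: Rintegral_quadratic_ge0 => //; first exact: ltW.
    by move=> y; have := Vup y xi; lra.
  have M_gt0 : 0 < M by rewrite /M; lra.
  have M1 : M^-1 <= c * E ^+ 2.
    by rewrite -[leRHS]invrK lef_pV2 ?posrE// /M; lra.
  have M2 : M^-1 <= c * L.
    by rewrite -[leRHS]invrK lef_pV2 ?posrE// /M; lra.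
  have M3 : C <= M by rewrite /M; lra.
  have M4 : C * L <= M by rewrite /M; lra.
  have xi2 := sqr_ge0 xi.
  rewrite qE; apply/andP; split.
    (* [lowB] bounds [V] below by [c * A + c * L * xi ^+ 2], and [NA] passes from [A] to the
       unweighted integral at the cost of [E ^+ 2]. *)
    have := ler_wpM2r N0 M1; have := ler_wpM2r xi2 M2; have := ler_wpM2l (ltW c_gt0) NA.
    lra.
  have := ler_wpM2r N0 M3; have := ler_wpM2r xi2 M4; have := ler_wpM2l (ltW C_gt0) AN.
  lra.
move=> phi0 xi0 _ _ phi xi phix phit sol t t_ge0.
have [gi g2i] := solution_integrable mu sol t_ge0.
refine (ex_intro _ _ (conj (V_derive_within (mu := mu) L_gt0 sol t_ge0) _)).
rewrite V_weighted// E2 -/E.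
set A := \int[_]_(x in _) (weighted _ _ _ ^+ 2).
set B := \int[_]_(x in _) weighted _ _ _.
set p := phi (L, t); set a := c2 / C; set z := xi t.
have aC : a * C = c2 by rewrite divfK ?gt_eqF.
have qE : r * kI * E * z ^+ 2 = d * z ^+ 2 * L by rewrite /d; field; rewrite gt_eqF.
(* The right-hand side is the claimed bound minus the derivative of [V]. Half of the boundary
   dissipation [r * E ^+ 2 * p ^+ 2] is reserved for the claim; the other half is spread over the
   interval to absorb the product of [p] and [B]. *)
have key : 0 <= (r * mu - a) * A + (r * kI * mu * z - 2 * kI * p - 2 * a * kI * z) * B +
    ((r * E ^+ 2 * p ^+ 2 / 2 + r * kI ^+ 2 * z ^+ 2) / L - a * d * z ^+ 2) * (L - 0).
  apply: Rintegral_quadratic_ge0 => //; first exact: ltW.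
  (* The form is the positive definite one of [dVlow], minus [a] times the
     integrand of [V], plus a perfect square coming from the boundary value [p]. *)
  move=> y; have h1 := dVlow y z.
  have h2 : a * (1 * y ^+ 2 + 2 * kI * y * z + d * z ^+ 2) <= c2 * (y ^+ 2 + z ^+ 2).
    by rewrite -aC -[a * C * _]mulrA ler_pM2l ?divr_gt0.
  have h3 : 0 <= X * y ^+ 2 - 2 * kI * p * y + r * E ^+ 2 * p ^+ 2 / 2 / L.
    have -> : X * y ^+ 2 - 2 * kI * p * y + r * E ^+ 2 * p ^+ 2 / 2 / L =
      r * E ^+ 2 / (2 * L) * (p - 2 * kI * L * y / (r * E ^+ 2)) ^+ 2.
      by rewrite /X; field; rewrite !gt_eqF.
    by rewrite mulr_ge0 ?sqr_ge0// ltW// divr_gt0// mulr_gt0.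
  move: h1 h2 h3; lra.
have eL u v : (u / L - v) * (L - 0) = u - v * L by field; rewrite gt_eqF.
move: key; rewrite eL qE -/a; lra.
Qed.
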